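(* For every integer $k\geq1$ the following identity of formal power series in $x$ and $t$ holds: $$\prod^\infty_{q=k}(1+tx^q)=1+\sum^\infty_{q=1}t^q\,x^{kq+\frac{3q(q-1)}{2}}\,\frac{(1+tx^k)(1+tx^{k+1})\cdots(1+tx^{q+k-2})\,(1+tx^{2q+k-1})}{(1-x)(1-x^2)\cdots(1-x^{q-1})(1-x^q)} .$$
   Context: For $q=1$ the product $(1+tx^k)\cdots(1+tx^{q+k-2})$ is empty and equals $1$, so the $q=1$ term is $t\,x^k\,\frac{1+tx^{k+1}}{1-x}$. *)

(* Defs.v *)
From HB Require Import structures.
From mathcomp Require Import all_boot all_order all_algebra.
From mathcomp Require Import boolp classical_sets.

Set Implicit Arguments.
Unset Strict Implicit.
Unset Printing Implicit Defensive.
Import GRing.Theory.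
Local Open Scope ring_scope.

(** [fps R] is the ring R[[X]] of formal power series: arbitrary coefficient
    sequences with the Cauchy product.  R[[x, t]] is taken to be R[[x]][[t]],
    that is [fps (fps R)]. *)
Record fps (R : Type) := Fps { fcoef : nat -> R }.

Lemma fpsP (R : Type) (f g : fps R) : (forall n, fcoef f n = fcoef g n) -> f = g.
Proof. by case: f g => [f] [g] /= fg; congr Fps; apply/funext. Qed.

HB.instance Definition _ (R : Type) := gen_eqMixin (fps R).
HB.instance Definition _ (R : Type) := gen_choiceMixin (fps R).

Section Ring.
Variable R : comNzRingType.
Implicit Types f g h : fps R.

Definition fps_zero : fps R := Fps (fun=> 0).
Definition fps_opp f : fps R := Fps (fun n => - fcoef f n).
Definition fps_add f g : fps R := Fps (fun n => fcoef f n + fcoef g n).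
Definition fpsC (c : R) : fps R := Fps (fun n => if n == 0%N then c else 0).
Definition fpsX : fps R := Fps (fun n => (n == 1%N)%:R).
Definition fps_mul f g : fps R :=
  Fps (fun n => \sum_(i < n.+1) fcoef f i * fcoef g (n - i)).

Fact fps_addA : associative fps_add.
Proof. by move=> f g h; apply: fpsP => n /=; rewrite addrA. Qed.
Fact fps_addC : commutative fps_add.
Proof. by move=> f g; apply: fpsP => n /=; rewrite addrC. Qed.
Fact fps_add0 : left_id fps_zero fps_add.
Proof. by move=> f; apply: fpsP => n /=; rewrite add0r. Qed.
Fact fps_addN : left_inverse fps_zero fps_opp fps_add.
Proof. by move=> f; apply: fpsP => n /=; rewrite addNr. Qed.

HB.instance Definition _ :=
  GRing.isZmodule.Build (fps R) fps_addA fps_addC fps_add0 fps_addN.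

Fact fcoef_mul_rev f g n :
  fcoef (fps_mul f g) n = \sum_(i < n.+1) fcoef f (n - i) * fcoef g i.
Proof.
rewrite /= (reindex_inj rev_ord_inj) /=; apply: eq_bigr => i _.
by rewrite subSS subKn ?leq_ord.
Qed.

Fact fps_mulC : commutative fps_mul.
Proof.
move=> f g; apply: fpsP => n; rewrite fcoef_mul_rev /=.
by apply: eq_bigr => i _; rewrite mulrC.
Qed.

Fact fps_mulA : associative fps_mul.
Proof.
move=> f g h; apply: fpsP => n; rewrite [RHS]fcoef_mul_rev.
pose c3 j k := fcoef f j * (fcoef g (n - j - k) * fcoef h k).
transitivity (\sum_(j < n.+1) \sum_(k < n.+1 | (k <= n - j)%N) c3 j k).
  transitivity (\sum_(j < n.+1) fcoef f j * fcoef (fps_mul g h) (n - j)) => //.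
  apply: eq_bigr => j _; rewrite fcoef_mul_rev.
  by rewrite big_distrr /= (big_ord_narrow_leq (leq_subr _ _)).
rewrite (exchange_big_dep predT) //=; apply: eq_bigr => k _.
transitivity (\sum_(j < n.+1 | (j <= n - k)%N) c3 j k).
  apply: eq_bigl => j; rewrite -ltnS -(ltnS j) -!subSn ?leq_ord //.
  by rewrite -subn_gt0 -(subn_gt0 j) -!subnDA addnC.
rewrite (big_ord_narrow_leq (leq_subr _ _)) big_distrl /=.
by apply: eq_bigr => j _; rewrite /c3 -!subnDA addnC mulrA.
Qed.

Fact fps_mul1 : left_id (fpsC 1) fps_mul.
Proof.
move=> f; apply: fpsP => n /=; rewrite big_ord_recl /= subn0 mul1r.
by rewrite big1 ?addr0 // => i _; rewrite mul0r.
Qed.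

Fact fps_mulDl : left_distributive fps_mul fps_add.
Proof.
move=> f g h; apply: fpsP => n /=; rewrite -big_split /=.
by apply: eq_bigr => i _; rewrite mulrDl.
Qed.

Fact fps_one_neq0 : fpsC 1 != 0.
Proof.
apply/eqP => /(congr1 (fun s => fcoef s 0)) /= /eqP.
by rewrite oner_eq0.
Qed.

HB.instance Definition _ :=
  GRing.Zmodule_isComNzRing.Build (fps R)
    fps_mulA fps_mulC fps_mul1 fps_mulDl fps_one_neq0.

(** The inverse is the (unique) ring inverse when there is one; as usual for
    [unitRingType], it is the identity on non-units. *)
Definition fps_unit : {pred fps R} := fun f => `[< exists g, g * f = 1 >].
Definition fps_inv f : fps R := xget f [set g | g * f = 1]%classic.

Fact fps_mulVf : {in fps_unit, left_inverse 1 fps_inv *%R}.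
Proof. by move=> f /asboolP [g gf]; exact: (@xgetI _ f [set h | h * f = 1]%classic g gf). Qed.
Fact fps_unitPl f g : g * f = 1 -> fps_unit f.
Proof. by move=> gf; apply/asboolP; exists g. Qed.
Fact fps_inv_out : {in [predC fps_unit], fps_inv =1 id}.
Proof.
move=> f /asboolPn nf; rewrite /fps_inv; apply: xgetPN => g gf.
by apply: nf; exists g.
Qed.

HB.instance Definition _ :=
  GRing.ComNzRing_hasMulInverse.Build (fps R) fps_mulVf fps_unitPl fps_inv_out.

End Ring.

Section Bivariate.
Variable R : comNzRingType.

Definition varx : fps (fps R) := fpsC (fpsX R).
Definition vart : fps (fps R) := fpsX (fps R).

(** Coefficient of x^i t^j. *)
Definition fcoef2 (f : fps (fps R)) (i j : nat) : R := fcoef (fcoef f j) i.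

(** Convergence for the (x, t)-adic topology: every coefficient is eventually
    constant. *)
Definition fps_cvg_to (u : nat -> fps (fps R)) (l : fps (fps R)) : Prop :=
  forall i j, exists N, forall n, (N <= n)%N -> fcoef2 (u n) i j = fcoef2 l i j.

Definition fps_cvg (u : nat -> fps (fps R)) : Prop := exists l, fps_cvg_to u l.

(** Meaningful only together with [fps_cvg u]; equal to 0 otherwise. *)
Definition fps_lim (u : nat -> fps (fps R)) : fps (fps R) :=
  xget 0 [set l | fps_cvg_to u l]%classic.

Lemma fps_cvg_unique u l l' : fps_cvg_to u l -> fps_cvg_to u l' -> l = l'.
Proof.
move=> ul ul'; apply: fpsP => j; apply: fpsP => i.
have [N HN] := ul i j; have [N' HN'] := ul' i j.
have := HN _ (leq_maxl N N'); have := HN' _ (leq_maxr N N').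
by rewrite /fcoef2 => -> ->.
Qed.

Lemma fps_limE u l : fps_cvg_to u l -> fps_lim u = l.
Proof.
move=> ul; apply: (fps_cvg_unique _ ul).
exact: (@xgetI _ 0 [set l | fps_cvg_to u l]%classic l ul).
Qed.

End Bivariate.

(* Main.v *)
Require Import Defs.
From mathcomp Require Import all_boot all_order all_algebra.
From mathcomp Require Import ring zify.
Import GRing.Theory.
Local Open Scope ring_scope.

(** This is Sylvester's identity.  Write [T k q] for the [q]-th summand on the
    right, [D q] for its denominator, and
    [A k q = t^q x^(kq + 3q(q-1)/2 + q) (1+tx^k)...(1+tx^(k+q-1)) / D q].

    Splitting the last factor of the numerator of [T k q] as
    [1 + t x^(2q+k-1) = x^q (1 + t x^(k+q-1)) + (1 - x^q)] gives
    [T k q = A k q + t x^(k+2(q-1)) A k (q-1)] ([sylvester_term_split]), whereas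
    pulling a factor [1 + t x^k] into [T (k+1) q] gives
    [(1 + t x^k) T (k+1) q = (1 + t x^(k+2q)) A k q] ([sylvester_term_shift]).
    Summed over [q <= n], with the constant [1 = A k 0] added to the first
    family and [1 + t x^k = (1 + t x^k) A k 0] to the second, the two right-hand
    sides agree up to one boundary term, which is divisible by [t^n].  So, modulo [t^n], the partial sums
    [F k = 1 + T k 1 + ... + T k n] satisfy [F k = (1 + t x^k) F (k+1)]
    ([sylvester_sum_step]) and, by iteration,
    [F k = (1 + t x^k)...(1 + t x^(m-1)) F m] ([sylvester_sum_iter]).

    Finally [F m] is [1] modulo [x^m] ([sylvester_sum_modX]).  Hence, for
    [n > j], [m > i] and [m >= k], the coefficients of [x^i t^j] in [F k] and in
    [(1 + t x^k)...(1 + t x^(m-1))] are equal ([sylvester_coef]).  As [n] and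
    [m] vary independently, both are eventually constant, with the same
    value. *)

(** * The recurrence in the shift parameter *)

(** The denominator (1-x)(1-x^2)...(1-x^q). *)
Definition qfact {A : comUnitRingType} (x : A) (q : nat) : A :=
  \prod_(1 <= j < q.+1) (1 - x ^+ j).

(** The [q]-th summand of Sylvester's series, for [q >= 1]. *)
Definition sylvester_term {A : comUnitRingType} (x t : A) (k q : nat) : A :=
  t ^+ q * x ^+ (k * q + (3 * (q * (q - 1))) %/ 2)
  * ((\prod_(k <= j < q + k - 1) (1 + t * x ^+ j))
       * (1 + t * x ^+ (2 * q + k - 1)))
  / qfact x q.

(** The auxiliary quantity in terms of which both decompositions of
    [sylvester_term] are expressed. *)
Definition sylvester_aux {A : comUnitRingType} (x t : A) (k q : nat) : A :=
  t ^+ q * x ^+ (k * q + (3 * (q * (q - 1))) %/ 2 + q)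
  * (\prod_(k <= j < k + q) (1 + t * x ^+ j)) / qfact x q.

Definition sylvester_sum {A : comUnitRingType} (x t : A) (k n : nat) : A :=
  1 + \sum_(1 <= q < n) sylvester_term x t k q.

Lemma sylvester_expS (q : nat) :
  ((3 * (q.+1 * (q.+1 - 1))) %/ 2)%N = ((3 * (q * (q - 1))) %/ 2 + 3 * q)%N.
Proof.
have -> : (3 * (q.+1 * (q.+1 - 1)) = 3 * q * 2 + 3 * (q * (q - 1)))%N.
  by case: q => // q; rewrite !subn1 /=; ring.
by rewrite divnMDl // addnC.
Qed.

Lemma sylvester_term_split (A : comUnitRingType) (x t : A) (k q : nat) :
  (forall j, (0 < j)%N -> 1 - x ^+ j \is a GRing.unit) ->
  sylvester_term x t k q.+1 =
  sylvester_aux x t k q.+1 + sylvester_aux x t k q * (t * x ^+ (k + 2 * q)).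
Proof.
move=> ux; rewrite /sylvester_term /sylvester_aux sylvester_expS.
have uq : qfact x q \is a GRing.unit.
  by rewrite /qfact big_nat; apply: rpred_prod => j /andP[j0 _]; exact: ux.
have -> : (qfact x q)^-1 = (1 - x ^+ q.+1) / qfact x q.+1.
  rewrite {2}/qfact big_nat_recr //= invrM ?ux //.
  by rewrite mulrA divrr ?ux // mul1r.
have -> : (q.+1 + k - 1 = k + q)%N by lia.
have -> : (2 * q.+1 + k - 1 = k + q + q.+1)%N by lia.
rewrite (addnS k q) big_nat_recr ?leq_addr //=.
set p := \prod_(_ <= _ < _) _; set d := _^-1; set e := (_ %/ _)%N.
have -> : (k * q.+1 + (e + 3 * q) = k * q + e + q + k + q + q)%N by lia.
have -> : (k + 2 * q = k + q + q)%N by lia.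
rewrite !exprD !exprS; ring.
Qed.

Lemma sylvester_term_shift (A : comUnitRingType) (x t : A) (k q : nat) :
  (1 + t * x ^+ k) * sylvester_term x t k.+1 q.+1 =
  sylvester_aux x t k q.+1 * (1 + t * x ^+ (k + 2 * q.+1)).
Proof.
rewrite /sylvester_term /sylvester_aux.
have -> : (q.+1 + k.+1 - 1 = k + q.+1)%N by lia.
have -> : (2 * q.+1 + k.+1 - 1 = k + 2 * q.+1)%N by lia.
rewrite [in RHS]big_ltn; last lia.
set p := \prod_(_ <= _ < _) _; set d := _^-1; set e := (_ %/ _)%N.
have -> : (k.+1 * q.+1 + e = k * q.+1 + e + q.+1)%N by lia.
set w := x ^+ (_ + q.+1); set b := 1 + t * x ^+ (k + _); ring.
Qed.

(** The functional equation [F k = (1 + t x^k) F (k+1)] of the series, with the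
    exact error made by truncating after [n] terms. *)
Lemma sylvester_sum_step (A : comUnitRingType) (x t : A) (k n : nat) :
  (forall j, (0 < j)%N -> 1 - x ^+ j \is a GRing.unit) ->
  sylvester_sum x t k n.+1 + sylvester_aux x t k n * (t * x ^+ (k + 2 * n)) =
  (1 + t * x ^+ k) * sylvester_sum x t k.+1 n.+1.
Proof.
move=> ux; rewrite /sylvester_sum; elim: n => [|n IH].
  (* Both sides are 1 + t x^k, as the auxiliary quantity for q = 0 is 1. *)
  rewrite !big_geq // /sylvester_aux /qfact !big_geq //; last lia.
  by rewrite !(mul0n, muln0, div0n, addn0, expr0, invr1, mulr1, mul1r, addr0).
rewrite !(big_nat_recr n.+1) //= sylvester_term_split //.
by rewrite [in RHS]addrA mulrDr -IH sylvester_term_shift; ring.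
Qed.

Lemma sylvester_sum_iter (A : comUnitRingType) (x t : A) (k d n : nat) :
  (forall j, (0 < j)%N -> 1 - x ^+ j \is a GRing.unit) ->
  exists h, sylvester_sum x t k n.+1 =
    (\prod_(k <= q < k + d) (1 + t * x ^+ q)) * sylvester_sum x t (k + d) n.+1
    + t ^+ n * h.
Proof.
move=> ux; elim: d => [|d [h IH]].
  by exists 0; rewrite addn0 big_geq // mul1r mulr0 addr0.
have := sylvester_sum_step _ x t (k + d) n ux.
rewrite /sylvester_aux -!mulrA; set g := (X in t ^+ n * X) => step.
exists (h - (\prod_(k <= q < k + d) (1 + t * x ^+ q)) * g).
rewrite IH addnS big_nat_recr ?leq_addr //= -mulrA -step; ring.
Qed.

Lemma sylvester_sum_modX (A : comUnitRingType) (x t : A) (m n : nat) :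
  exists h, sylvester_sum x t m n = 1 + x ^+ m * h.
Proof.
rewrite /sylvester_sum.
suff [h ->] : exists h, \sum_(1 <= q < n) sylvester_term x t m q = x ^+ m * h.
  by exists h.
elim: n => [|[|n] [h IH]]; try by exists 0; rewrite big_geq // mulr0.
rewrite big_nat_recr //= IH /sylvester_term mulnS -[in X in _ + X]addnA exprD.
set u := x ^+ (_ + _); set w := _ * (1 + _); set d := _^-1.
by exists (h + t ^+ n.+1 * u * w * d); ring.
Qed.

(** * Coefficients in R[[x, t]] *)

Lemma fcoef_mulX (R : comNzRingType) (f : fps R) (n : nat) :
  fcoef (fpsX R * f) n = if n is n'.+1 then fcoef f n' else 0.
Proof.
rewrite /GRing.mul /=; case: n => [|n]; first by rewrite big_ord1 mul0r.
rewrite 2!big_ord_recl /= mul0r add0r mul1r subSS subn0 big1 ?addr0 //.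
by move=> i _; rewrite mul0r.
Qed.

Lemma fcoef_mulC (R : comNzRingType) (c : R) (f : fps R) (n : nat) :
  fcoef (fpsC c * f) n = c * fcoef f n.
Proof.
rewrite /GRing.mul /= big_ord_recl /= subn0 big1 ?addr0 //.
by move=> i _; rewrite mul0r.
Qed.

Lemma fcoef2P (R : comNzRingType) (f g : fps (fps R)) :
  (forall i j, fcoef2 f i j = fcoef2 g i j) -> f = g.
Proof. by move=> fg; apply: fpsP => j; apply: fpsP => i; exact: fg. Qed.

Lemma fcoef2D (R : comNzRingType) (f g : fps (fps R)) (i j : nat) :
  fcoef2 (f + g) i j = fcoef2 f i j + fcoef2 g i j.
Proof. by []. Qed.

Lemma fcoef2_1 (R : comNzRingType) (i j : nat) :
  fcoef2 (1 : fps (fps R)) i j = ((i == 0%N) && (j == 0%N))%:R.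
Proof. by rewrite /fcoef2 /GRing.one /=; case: j => [|j] /=; case: i. Qed.

Lemma fcoef2_mul_vartX (R : comNzRingType) (n : nat) (f : fps (fps R))
    (i j : nat) :
  fcoef2 (vart R ^+ n * f) i j = if (j < n)%N then 0 else fcoef2 f i (j - n).
Proof.
elim: n j => [|n IH] j; first by rewrite mul1r subn0.
rewrite exprS -mulrA /fcoef2 fcoef_mulX; case: j => [|j] //=; exact: IH.
Qed.

Lemma fcoef2_mul_varxX (R : comNzRingType) (n : nat) (f : fps (fps R))
    (i j : nat) :
  fcoef2 (varx R ^+ n * f) i j = if (i < n)%N then 0 else fcoef2 f (i - n) j.
Proof.
elim: n i => [|n IH] i; first by rewrite mul1r subn0.
rewrite exprS -mulrA /fcoef2 fcoef_mulC fcoef_mulX; case: i => [|i] //=.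
exact: IH.
Qed.

Lemma unit_1subvarxX (R : comNzRingType) (n : nat) :
  (0 < n)%N -> 1 - varx R ^+ n \is a GRing.unit.
Proof.
move=> n_gt0.
(* The geometric series 1 + x^n + x^2n + ... *)
pose g : fps (fps R) :=
  Fps (fun j => Fps (fun i => ((n %| i)%N && (j == 0%N))%:R)).
suff eg : g = 1 + varx R ^+ n * g.
  apply/unitrPr; exists g; rewrite mulrBl mul1r {1}eg; exact: addrK.
apply: fcoef2P => i j; rewrite fcoef2D fcoef2_1 fcoef2_mul_varxX /fcoef2 /=.
case: ltnP => [lt_in|le_ni].
  by rewrite addr0 /dvdn modn_small.
by rewrite dvdn_subl // (gtn_eqF (leq_trans n_gt0 le_ni)) add0r.
Qed.

(** * The limit *)

Lemma sylvester_coef (R : comNzRingType) (k m n i j : nat) :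
  (k <= m)%N -> (i < m)%N -> (j < n)%N ->
  fcoef2 (sylvester_sum (varx R) (vart R) k n.+1) i j =
  fcoef2 (\prod_(k <= q < m) (1 + vart R * varx R ^+ q)) i j.
Proof.
move=> le_km lt_im lt_jn.
have [h] := sylvester_sum_iter _ (varx R) (vart R) k (m - k) n
              (@unit_1subvarxX R).
rewrite subnKC //; have [g ->] := sylvester_sum_modX _ (varx R) (vart R) m n.+1.
move=> ->; rewrite mulrDr mulr1 mulrCA !fcoef2D.
by rewrite fcoef2_mul_varxX fcoef2_mul_vartX lt_im lt_jn !addr0.
Qed.

Theorem mainTheorem10 (R : comNzRingType) (k : nat) (hk : (1 <= k)%N) :
  let x := varx R in
  let t := vart R in
  let P := fun n : nat => \prod_(k <= q < n) (1 + t * x ^+ q) in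
  let S := fun n : nat =>
    \sum_(1 <= q < n)
      t ^+ q * x ^+ (k * q + (3 * (q * (q - 1))) %/ 2)
      * ((\prod_(k <= j < q + k - 1) (1 + t * x ^+ j))
           * (1 + t * x ^+ (2 * q + k - 1)))
      / \prod_(1 <= j < q.+1) (1 - x ^+ j) in
  fps_cvg P /\ fps_cvg S /\ fps_lim P = 1 + fps_lim S.
Proof.
move=> x t P S.
have coefE m n i j : (k <= m)%N -> (i < m)%N -> (j < n)%N ->
    fcoef2 (1 + S n.+1) i j = fcoef2 (P m) i j by exact: sylvester_coef.
pose l : fps (fps R) :=
  Fps (fun j => Fps (fun i => fcoef2 (P (maxn k i.+1)) i j)).
have Pl : fps_cvg_to P l.
  move=> i j; exists (maxn k i.+1) => n; rewrite geq_max => /andP[le_kn lt_in].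
  rewrite [RHS]/(fcoef2 (P (maxn k i.+1)) i j) -(coefE n j.+1) //.
  by apply: coefE => //; [exact: leq_maxl | exact: leq_maxr].
have Sl : fps_cvg_to S (l - 1).
  move=> i j; exists j.+2 => -[|n] // lt_jn.
  have := coefE (maxn k i.+1) n i j (leq_maxl _ _) (leq_maxr _ _) lt_jn.
  rewrite !fcoef2D => e; apply: (@addrI _ (fcoef2 1 i j)); rewrite e.
  by rewrite addrC [fcoef2 (-1) i j]/(- fcoef2 1 i j) subrK.
split; first by exists l.
split; first by exists (l - 1).
by rewrite (fps_limE Pl) (fps_limE Sl) addrC subrK.
Qed.
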